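(* Let $(\Sigma,\sigma)$ be a topologically mixing one-sided Markov shift over a finite alphabet. Let $\Phi=(\phi_n)_n$ be an asymptotically additive sequence of continuous functions on $\Sigma$ and let $\mu$ be a weak Gibbs measure for $\Phi$. Then there exists an asymptotically additive sequence $\Psi=(\psi_n)_n$ of continuous functions on $\Sigma$ such that $\mu$ is a Gibbs measure for $\Psi$.
   Context: Markov shift: given a finite alphabet $\mathcal{A}$ (a finite set of integers) and a $0$-$1$ matrix $T=(t_{ij})_{\mathcal{A}\times\mathcal{A}}$, set $\Sigma=\{\omega\in\mathcal{A}^{\mathbb{N}}: t_{\omega_i\omega_{i+1}}=1 \text{ for every } i\in\mathbb{N}\}$, with shift map $\sigma(\omega_1\omega_2\dots)=(\omega_2\omega_3\dots)$. It is topologically mixing if there is a positive integer $l$ such that all entries of $T^l$ are strictly positive. Cylinders of length $n$: $C_{i_1\cdots i_n}=\{\omega\in\Sigma:\omega_j=i_j,\ 1\le j\le n\}$; they generate the topology of $\Sigma$, also induced by the metric $d(\omega,\kappa)=\sum_{i\ge1}|\omega_i-\kappa_i|/2^i$. For $\rho:\Sigma\to\mathbb{R}$, $S_n\rho=\sum_{j=0}^{n-1}\rho\circ\sigma^j$. A sequence $\Phi=(\phi_n)_n$ of continuous functions $\phi_n:\Sigma\to\mathbb{R}$ is asymptotically additive if for every $\epsilon>0$ there is a continuous function $\rho_\epsilon:\Sigma\to\mathbb{R}$ with $\limsup_{n\to\infty}\frac1n\|\phi_n-S_n\rho_\epsilon\|<\epsilon$, where $\|\cdot\|$ is the supremum norm.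 Topological pressure: a subset $E\subset\Sigma$ is $(n,\epsilon)$-separated if $\max_{0\le i\le n-1}d(\sigma^i\omega,\sigma^i\kappa)>\epsilon$ for all distinct $\omega,\kappa\in E$. Put $P(\Phi,n,\epsilon)=\sup\{\sum_{\omega\in E}\exp(\phi_n(\omega)): E\subset\Sigma \text{ is } (n,\epsilon)\text{-separated}\}$ and $P(\Phi)=\lim_{\epsilon\to0}\limsup_{n\to\infty}\frac1n\log P(\Phi,n,\epsilon)$. A Borel probability measure $\mu$ on $\Sigma$ (not necessarily $\sigma$-invariant) is a weak Gibbs measure for the asymptotically additive sequence $\Phi$ if there are positive reals $K(n)$ with $\lim_{n\to\infty}\frac{\log K(n)}{n}=0$ such that for every $n\in\mathbb{N}$, every cylinder $C_{i_1\dots i_n}$ and every $\omega\in C_{i_1\dots i_n}$, $$\frac1{K(n)}\le\frac{\mu(C_{i_1\dots i_n})}{\exp(\phi_n(\omega)-nP(\Phi))}\le K(n).$$ It is a Gibbs measure for $\Phi$ if this holds with $K(n)=K$ a constant independent of $n$. *)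

(* Defs.v *)
From HB Require Import structures.
From mathcomp Require Import all_boot all_order all_algebra finmap.
From mathcomp Require Import all_classical all_reals all_analysis.

Set Implicit Arguments.
Unset Strict Implicit.
Unset Printing Implicit Defensive.

Import Order.TTheory GRing.Theory Num.Theory.
Import numFieldNormedType.Exports.

Local Open Scope classical_set_scope.
Local Open Scope ring_scope.

(* Sequences are indexed from 0: the letter [w i] is the letter of index i + 1
   of the mathematical text. *)
Definition sequences (A : {fset int}) : Type :=
  prod_topology (fun _ : nat => discrete_topology A).

HB.instance Definition _ (A : {fset int}) := Topological.on (sequences A).

Definition admissible (A : {fset int}) (T : rel A) : set (sequences A) :=
  [set w | forall i : nat, T (w i) (w i.+1)].

(* [transition i j] holds iff the entry t_ij of the 0-1 matrix is 1.
   Measurable types of the library are pointed, so the empty shift has to be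
   excluded here; it carries no probability measure. *)
Record markovShift := MarkovShift {
  alphabet : {fset int} ;
  transition : rel alphabet ;
  admissible_neq0 : admissible transition !=set0 }.

(* The topology is induced by the product of the discrete topologies. *)
Definition shift_space (S : markovShift) : Type :=
  set_type (admissible (@transition S)).

Coercion shift_space : markovShift >-> Sortclass.

HB.instance Definition _ (S : markovShift) := Topological.on (shift_space S).

Definition shift_point (S : markovShift) : shift_space S :=
  let: exist w wS := cid (admissible_neq0 S) in exist _ w (mem_set wS).

HB.instance Definition _ (S : markovShift) :=
  isPointed.Build (shift_space S) (shift_point S).

Section MarkovShift.
Variable S : markovShift.

Definition letter (w : S) (i : nat) : alphabet S := \val w i.

Lemma shift_subproof (w : S) :
  admissible (@transition S) (fun i => letter w i.+1).
Proof. by case: w => w wS i; have := set_mem wS; exact. Qed.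

Definition shift (w : S) : S :=
  exist (fun s => s \in admissible (@transition S)) _
    (mem_set (shift_subproof w)).

Definition transition_matrix : 'M[nat]_#|{: alphabet S}| :=
  \matrix_(i, j) nat_of_bool (transition (enum_val i) (enum_val j)).

Definition topologically_mixing : Prop :=
  exists2 l : nat, (0 < l)%N &
    forall i j, (0 < (transition_matrix ^+ l) i j)%N.

Definition cylinder (n : nat) (c : n.-tuple (alphabet S)) : set S :=
  [set w | forall j : 'I_n, letter w j = tnth c j].

Definition borel : Type := g_sigma_algebraType (@open (shift_space S)).

HB.instance Definition _ := Measurable.on borel.

Variable R : realType.

Definition dist (w k : S) : R :=
  limn (series (fun i =>
    `|\val (letter w i) - \val (letter k i)|%:~R / 2 ^+ i.+1 : R)).

Definition birkhoff_sum (rho : S -> R) (n : nat) (w : S) : R :=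
  \sum_(j < n) rho (iter j shift w).

Definition sup_norm (f : S -> R) : \bar R :=
  ereal_sup (range (fun w => `|f w|%:E)).

(* In a sequence of functions (phi_n), the index n is positive: the term of
   index 0 is never constrained. *)
Definition asymptotically_additive (Phi : nat -> S -> R) : Prop :=
  (forall n, (0 < n)%N -> continuous (Phi n)) /\
  forall eps : R, 0 < eps ->
    exists2 rho : S -> R, continuous rho &
      (limn_esup (fun n =>
         n%:R^-1%:E * sup_norm (fun w => (Phi n w - birkhoff_sum rho n w)%R))
       < eps%:E)%E.

Definition separated_set (n : nat) (eps : R) (E : set S) : Prop :=
  forall w k, E w -> E k -> w <> k ->
    eps < \big[Num.max/0]_(i < n) dist (iter i shift w) (iter i shift k).

Definition partition_function (Phi : nat -> S -> R) (n : nat) (eps : R) :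
    \bar R :=
  ereal_sup [set (\esum_(w in E) (expR (Phi n w))%:E)%E
            | E in [set E : set S | separated_set n eps E]].

Definition pressure (Phi : nat -> S -> R) : \bar R :=
  lim ((fun eps : R =>
          limn_esup (fun n =>
            n%:R^-1%:E * lne (partition_function Phi n eps))%E)
       @ 0^'+).

(* The pressure of an asymptotically additive sequence is finite, so that
   [fine] loses nothing there. *)
Definition gibbs_bounds (Phi : nat -> S -> R) (mu : probability borel R)
    (K : nat -> R) : Prop :=
  forall n : nat, (0 < n)%N ->
  forall (c : n.-tuple (alphabet S)) (w : S), cylinder c w ->
    (K n)^-1 <= fine (mu (cylinder c)) /
                expR (Phi n w - n%:R * fine (pressure Phi)) <= K n.

Definition weak_gibbs (Phi : nat -> S -> R) (mu : probability borel R) : Prop :=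
  exists K : nat -> R,
    [/\ forall n, (0 < n)%N -> 0 < K n,
        ln (K n) / n%:R @[n --> \oo] --> (0 : R) &
        gibbs_bounds Phi mu K].

Definition gibbs (Phi : nat -> S -> R) (mu : probability borel R) : Prop :=
  exists2 K : R, 0 < K & gibbs_bounds Phi mu (fun=> K).

End MarkovShift.

(* Main.v *)
Require Import Defs.
From mathcomp Require Import all_boot all_order all_algebra finmap.
From mathcomp Require Import all_classical all_reals all_analysis.

(** Put [psi_n w = log mu(C_n(w)) + n P(Phi)], where [C_n(w)] is the cylinder of
    length [n] around [w].  The weak Gibbs bounds say precisely that
    [|psi_n - phi_n| <= log K(n) = o(n)]; such a perturbation changes neither
    asymptotic additivity nor the pressure, and [psi_n] is locally constant.
    Hence [P(Psi) = P(Phi)] and the Gibbs quotient of [mu] for [Psi] is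
    identically 1. *)

Set Implicit Arguments.
Unset Strict Implicit.
Unset Printing Implicit Defensive.

Import Order.TTheory GRing.Theory Num.Theory.
Import numFieldNormedType.Exports.

Local Open Scope classical_set_scope.
Local Open Scope ring_scope.

(** An upper limit is the infimum of the suprema over the sets [V] of the filter at infinity. Such a
    [V] can be cut down to its positive indices with [d n <= e] and stays in the filter, so passing
    from [v] to [u] costs at most [e]. *)
Lemma le_limn_esup_vanishing (R : realType) (u v : nat -> \bar R)
    (d : nat -> R) :
  d n @[n --> \oo] --> (0 : R) ->
  (forall n, (0 < n)%N -> (u n <= v n + (d n)%:E)%E) ->
  (limn_esup u <= limn_esup v)%E.
Proof.
move=> d0 uv; apply/lee_addgt0Pr => e e0.
rewrite -leeBlDr//; apply: le_ereal_inf_tmp => _ [V V_oo <-].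
rewrite leeBlDr//.
have dV : \forall n \near \oo, V n /\ (0 < n)%N /\ d n <= e.
  near=> n; split; first by near: n.
  split; first by near: n; exists 1%N.
  near: n; have := @cvgr_le _ _ _ _ _ _ d0.
  exact.
apply: (@le_trans _ _ (ereal_sup (u @` [set n | V n /\ (0 < n)%N /\ d n <= e]))).
  by apply: ereal_inf_lbound; exists [set n | V n /\ (0 < n)%N /\ d n <= e].
apply: ge_ereal_sup => _ [n [Vn [n0 dn]] <-].
apply: (le_trans (uv n n0)); apply: leeD; last by rewrite lee_fin.
by apply: ereal_sup_ubound; exists n.
Unshelve. all: by end_near. Qed.

(** The sum over [E] is a supremum over finite subsets, and [k] factors out of each finite sum. *)
Lemma le_esumZl (R : realType) (T : choiceType) (E : set T) (k : R)
    (f : T -> \bar R) : 0 < k -> (forall x, (0 <= f x)%E) ->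
  (\esum_(x in E) (k%:E * f x) <= k%:E * \esum_(x in E) f x)%E.
Proof.
move=> k0 f0; apply: ge_ereal_sup => _ [A EA <-].
rewrite -ge0_mule_fsumr//; apply: lee_wpmul2l; first by rewrite lee_fin ltW.
by apply: ereal_sup_ubound; exists A.
Qed.

Section Perturbation.
Variables (R : realType) (S : markovShift).
Implicit Types (Phi Psi : nat -> S -> R) (d : nat -> R).

(** A singleton is vacuously separated. Positivity is what allows [lne] to turn products of
    partition functions into sums. *)
Lemma partition_function_gt0 Phi n eps :
  (0 < partition_function Phi n eps)%E.
Proof.
apply: (@lt_le_trans _ _ (expR (Phi n (shift_point S)))%:E).
  by rewrite lte_fin expR_gt0.
apply: ereal_sup_ubound; exists [set shift_point S].
  by move=> w k -> ->.
by rewrite esum_set1// lee_fin expR_ge0.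
Qed.

Lemma le_partition_function Phi Psi n (a eps : R) :
  (forall w, Psi n w <= Phi n w + a) ->
  (partition_function Psi n eps <= (expR a)%:E * partition_function Phi n eps)%E.
Proof.
move=> PsiPhi; apply: ge_ereal_sup => _ [E sE <-].
apply: (@le_trans _ _
  ((expR a)%:E * \esum_(w in E) (expR (Phi n w))%:E)%E); last first.
  apply: lee_wpmul2l; first by rewrite lee_fin expR_ge0.
  by apply: ereal_sup_ubound; exists E.
apply: le_trans; last first.
  by apply: le_esumZl => [|w]; rewrite ?lee_fin ?expR_gt0// expR_ge0.
apply: le_esum => w _.
by rewrite -EFinM lee_fin -expRD ler_expR addrC.
Qed.

Lemma le_limn_esup_partition_function Phi Psi d (eps : R) :
  d n / n%:R @[n --> \oo] --> (0 : R) ->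
  (forall n w, (0 < n)%N -> Psi n w <= Phi n w + d n) ->
  (limn_esup (fun n => n%:R^-1%:E * lne (partition_function Psi n eps)) <=
   limn_esup (fun n => n%:R^-1%:E * lne (partition_function Phi n eps)))%E.
Proof.
move=> d0 PsiPhi; apply: (le_limn_esup_vanishing d0) => n n0.
(* Distributivity holds in the extended reals because [d n] is finite, even where the other summand
   is infinite. *)
rewrite [d n / _]mulrC EFinM -muleDr; last 2 first.
- by [].
- by rewrite fin_num_adde_defl.
apply: lee_wpmul2l; first by rewrite lee_fin invr_ge0.
have Z0 Xi := partition_function_gt0 Xi n eps.
(* Under [lne] the factor [expR (d n)] becomes the summand [d n]. *)
have <- : lne (expR (d n))%:E = (d n)%:E by rewrite lne_EFin ?expRK ?expR_gt0.
rewrite addeC -lneM ?in_itv/= ?leey ?andbT ?lte_fin ?expR_gt0//.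
rewrite lee_lne ?in_itv/= ?leey ?andbT ?mule_ge0 ?lee_fin ?expR_ge0 ?(ltW (Z0 _))//.
by apply: le_partition_function => w; exact: PsiPhi.
Qed.

(** The growth rates agree at every fixed [eps], so both pressures are limits of one and the same
    function of [eps]. *)
Lemma eq_pressure Phi Psi d :
  d n / n%:R @[n --> \oo] --> (0 : R) ->
  (forall n w, (0 < n)%N -> `|Psi n w - Phi n w| <= d n) ->
  pressure Psi = pressure Phi.
Proof.
move=> d0 dist_d.
pose growth (Xi : nat -> S -> R) (eps : R) : \bar R :=
  limn_esup (fun n => n%:R^-1%:E * lne (partition_function Xi n eps))%E.
suff growthE : growth Psi = growth Phi.
  exact: (congr1 (fun g : R -> \bar R => lim (g @ 0^'+)) growthE).
apply/funext => eps; apply/le_anti/andP.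
split; apply: (le_limn_esup_partition_function _ d0) => n w n0.
  by rewrite -lerBlDl (le_trans (ler_norm _))// dist_d.
by rewrite -lerBlDl (le_trans (ler_norm _))// distrC dist_d.
Qed.

(** The [rho] that serves [Phi] at scale [eps] serves [Psi] as well: by the triangle inequality the
    norm grows by at most [d n], which does not raise the upper limit. *)
Lemma asymptotically_additive_perturb Phi Psi d :
  (forall n, (0 < n)%N -> continuous (Psi n)) ->
  d n / n%:R @[n --> \oo] --> (0 : R) ->
  (forall n w, (0 < n)%N -> `|Psi n w - Phi n w| <= d n) ->
  asymptotically_additive Phi -> asymptotically_additive Psi.
Proof.
move=> cPsi d0 dist_d [_ aaPhi]; split=> // eps /aaPhi[rho crho rho_eps].
exists rho => //; apply: le_lt_trans rho_eps.
apply: (le_limn_esup_vanishing d0) => n n0.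
rewrite [d n / _]mulrC EFinM -muleDr; last 2 first.
- by [].
- by rewrite fin_num_adde_defl.
apply: lee_wpmul2l; first by rewrite lee_fin invr_ge0.
apply: ge_ereal_sup => _ [w _ <-].
apply: (@le_trans _ _ (`|Phi n w - birkhoff_sum rho n w| + d n)%:E).
  rewrite lee_fin -[X in `|X - _|](subrK (Phi n w)) -addrA.
  by rewrite (le_trans (ler_normD _ _))// [leRHS]addrC lerD2r dist_d.
by rewrite EFinD leeD2r//; apply: ereal_sup_ubound; exists w.
Qed.

Definition prefix n (w : S) : n.-tuple (alphabet S) :=
  [tuple letter w i | i < n].

Lemma cylinder_prefix n (w : S) : cylinder (prefix n w) w.
Proof. by move=> j; rewrite tnth_mktuple. Qed.

Lemma prefix_cylinder n (c : n.-tuple (alphabet S)) (w : S) :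
  cylinder c w -> prefix n w = c.
Proof. by move=> cw; apply: eq_from_tnth => j; rewrite tnth_mktuple cw. Qed.

Lemma letter_continuous i :
  continuous (fun w : S => letter w i : discrete_topology (alphabet S)).
Proof.
move=> w; apply: (@continuous_comp _ _ _ (\val : S -> sequences (alphabet S))
  (fun s => s i)).
  exact: initial_continuous.
exact: (@proj_continuous _ (fun=> discrete_topology (alphabet S)) i).
Qed.

(** Only finitely many letters are involved, and each is locally constant because singletons are
    open in the discrete topology. *)
Lemma prefix_locally_constant n (w : S) :
  \forall k \near w, prefix n k = prefix n w.
Proof.
have : \forall k \near w, forall j : 'I_n, letter k j = letter w j.
  apply: (@filter_forall _ _ (fun j : 'I_n => [set k | letter k j = letter w j])
    _ (nbhs_filter w)) => j.
  exact: (@letter_continuous j w [set letter w j]).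
by apply: filterS => k kw; apply: eq_from_tnth => j; rewrite !tnth_mktuple kw.
Qed.

Lemma continuous_prefix n (f : n.-tuple (alphabet S) -> R) :
  continuous (fun w : S => f (prefix n w)).
Proof.
move=> w; apply: near_cst_continuous.
by near do congr f; exact: prefix_locally_constant.
Unshelve. all: by end_near. Qed.

End Perturbation.

Theorem theorem2p1 (R : realType) (S : markovShift)
    (Smixing : topologically_mixing S)
    (Phi : nat -> S -> R) (aaPhi : asymptotically_additive Phi)
    (mu : probability (borel S) R) (wgmu : weak_gibbs Phi mu) :
  exists Psi : nat -> S -> R, asymptotically_additive Psi /\ gibbs Psi mu.
Proof.
have [K [K0 lnKn0 gK]] := wgmu.
set P := fine (pressure Phi).
pose m n (c : n.-tuple (alphabet S)) : R := fine (mu (cylinder c)).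
pose Psi n (w : S) : R := ln (m n (prefix n w)) + n%:R * P.
(* The lower weak Gibbs bound forces every nonempty cylinder to have positive measure, so [expR]
   inverts [ln] on these measures. *)
have m0 n w : (0 < n)%N -> 0 < m n (prefix n w).
  move=> n0; have /andP[+ _] := gK n n0 _ _ (@cylinder_prefix S n w).
  move=> /(lt_le_trans _) => /(_ 0); rewrite invr_gt0 K0// => /(_ isT).
  by rewrite pmulr_lgt0// invr_gt0 expR_gt0.
have PsiPhi n w : (0 < n)%N -> `|Psi n w - Phi n w| <= ln (K n).
  move=> n0; have /andP[] := gK n n0 _ _ (@cylinder_prefix S n w).
  (* With every factor written as an exponential, monotonicity of [expR] makes the two bounds linear
     inequalities. *)
  rewrite -/(m n _) -/P -expRN -[m n _]lnK ?posrE ?m0// -expRD.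
  rewrite -[K n]lnK ?posrE ?K0// -expRN !ler_expR expRK => lo up.
  rewrite ler_norml /Psi; apply/andP; split.
    by apply: (le_trans lo); rewrite opprB addrA.
  by apply: (le_trans _ up); rewrite opprB addrA.
have pE : pressure Psi = pressure Phi := eq_pressure lnKn0 PsiPhi.
exists Psi; split.
  apply: (asymptotically_additive_perturb _ lnKn0 PsiPhi aaPhi) => n n0.
  exact: (@continuous_prefix R S n (fun c => ln (m n c) + n%:R * P)).
exists 1; first exact: ltr01.
move=> n n0 c w cw.
have mc0 : 0 < m n c by rewrite -(prefix_cylinder cw) m0.
(* The Gibbs quotient is normalised by the pressure of [Psi]; by [pE] it is [P], which cancels the
   term [n%:R * P] of [Psi]. *)
rewrite pE -/P /Psi addrK (prefix_cylinder cw) -/(m n c).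
by rewrite (@lnK R (m n c) mc0) (divff (lt0r_neq0 mc0)) invr1 lexx.
Qed.
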